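(* Let $M(x)$ be the generating function of the Motzkin numbers and $F(x,4)=M(x)^4$. For every integer $n\ge 0$, \begin{align*} H_{12n}(F(x,4))&=H_{12n+1}(F(x,4))=1,\\ H_{12n+2}(F(x,4))&=2(2n+1)(8n-1),\\ H_{12n+3}(F(x,4))&=-2(8n+9)(2n+1),\\ H_{12n+4}(F(x,4))&=H_{12n+5}(F(x,4))=-1,\\ H_{12n+6}(F(x,4))&=4(n+1)(8n+5),\\ H_{12n+7}(F(x,4))&=H_{12n+10}(F(x,4))=-64(n+1)^2,\\ H_{12n+8}(F(x,4))&=H_{12n+9}(F(x,4))=0,\\ H_{12n+11}(F(x,4))&=-4(n+1)(8n+11). \end{align*}
   Context: The Motzkin numbers are $M_n=\sum_{k\ge 0}\binom{n}{2k}C_k$, where $C_k=\frac{1}{k+1}\binom{2k}{k}$ is the $k$-th Catalan number; equivalently $M(x)=\sum_{n\ge0}M_nx^n=\frac{1-x-\sqrt{1-2x-3x^2}}{2x^2}$. For a formal power series $A(x)=\sum_{n\ge 0}a_nx^n$, its Hankel determinants are $H_n(A(x))=\det(a_{i+j})_{0\le i,j\le n-1}$ for $n\ge1$, and $H_0(A(x))=1$.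
   Formalization: The printed value H_{12n+7}(F(x,4)) = -64(n+1)^2 has the wrong sign (for n=0 the determinant H_7 is +64); what is proved is H_{12n+7} = 64(n+1)^2, with H_{12n+10} = -64(n+1)^2 and all other values as printed. *)

(* Defs.v *)
From mathcomp Require Import all_boot all_order all_algebra.
From mathcomp Require Import zify.

Set Implicit Arguments.
Unset Strict Implicit.
Unset Printing Implicit Defensive.

Import GRing.Theory.

Local Open Scope ring_scope.

(* A formal power series is represented by its coefficient sequence. *)
Definition fps (R : pzRingType) := nat -> R.

Definition fps_one (R : pzRingType) : fps R := fun n => (n == 0%N)%:R.

Definition fps_mul (R : pzRingType) (a b : fps R) : fps R :=
  fun n => \sum_(i < n.+1) a i * b (n - i)%N.

Definition fps_exp (R : pzRingType) (a : fps R) (k : nat) : fps R :=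
  iter k (fps_mul a) (fps_one R).

(* For n = 0 this is the determinant of the empty matrix, i.e. 1 (det_mx00). *)
Definition hankel (R : comPzRingType) (n : nat) (a : fps R) : R :=
  \det (\matrix_(i < n, j < n) a (i + j)%N).

Definition catalan (k : nat) : nat := ('C(2 * k, k) %/ k.+1)%N.

(* The Euclidean division in catalan is exact. *)
Lemma catalanE (k : nat) : (k.+1 * catalan k = 'C(2 * k, k))%N.
Proof.
rewrite /catalan mulnC divnK //.
have co : coprime k.+1 k by rewrite coprimeSn.
rewrite -(Gauss_dvdr _ co).
have -> : (k * 'C(2 * k, k) = k.+1 * 'C(2 * k, k.+1))%N.
  by rewrite mul_bin_left; congr (_ * _)%N; lia.
exact: dvdn_mulr.
Qed.

(* The terms with 2k > n vanish, so summing over k <= n loses nothing. *)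
Definition motzkin (n : nat) : nat :=
  (\sum_(k < n.+1) 'C(n, 2 * k) * catalan k)%N.

Definition motzkin_gf : fps int := fun n => (motzkin n)%:Z.

(* F(x, r) = M(x)^r *)
Definition F (r : nat) : fps int := fps_exp motzkin_gf r.

(* Main.v *)
(* Let S_k be the monic Chebyshev polynomials S_(k+2) = X S_(k+1) - S_k and L
   the functional for which they are orthonormal (its moments are aerated
   Catalan numbers). Then L((1 + X)^n S_k) counts Motzkin paths from 0 to height
   k, and splitting such paths at their last visits to the heights 0, ..., k - 1
   gives [x^n] M^4 = L((1 + X)^(n+3) S_3). So the Hankel determinants of M^4 are
   those of L weighted by q = (1 + X)^3 S_3, and Christoffel's formula turns the
   N-th one into the 6 x 6 determinant of the residues of S_N, ..., S_(N+5)
   modulo q. As q = (X + 1)^3 (X^3 - 2X), the residue of S_m modulo X^3 - 2X has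
   period 8 in m, and the one modulo (X + 1)^3 is quadratic in m on each class
   modulo 3. *)

From HB Require Import structures.
Require Import Defs.
From mathcomp Require Import all_boot all_order all_algebra.
From mathcomp Require Import fingroup perm zify ring.

Import GRing.Theory.

Local Open Scope ring_scope.

(** * Determinants: change of basis and Christoffel's formula *)

(** The transition matrix from the monomials to [f] is lower unitriangular. *)
Lemma det_monic_family (R : comNzRingType) (N : nat)
    (psi : {linear {poly R} -> 'rV[R]_N}) (f : nat -> {poly R}) :
  (forall i, f i \is monic) -> (forall i, size (f i) = i.+1) ->
  \det (\matrix_(i < N) psi (f i)) = \det (\matrix_(i < N) psi 'X^i).
Proof.
move=> f_monic f_size.
have -> : \matrix_(i < N) psi (f i) =
    (\matrix_(i < N, k < N) (f i)`_k) *m \matrix_(i < N) psi 'X^i.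
  apply/matrixP => i c; rewrite !mxE -{1}(coefK (f i)) f_size poly_def.
  rewrite (big_ord_widen _ (fun k => (f i)`_k *: 'X^k) (ltn_ord i)) big_mkcond.
  rewrite linear_sum summxE; apply: eq_bigr => k _; rewrite !mxE.
  case: ltnP => ik; first by rewrite linearZ mxE.
  by rewrite nth_default ?f_size // linear0 mxE mul0r.
rewrite det_mulmx det_trig; last first.
  apply/is_trig_mxP => i k ik; rewrite mxE nth_default // f_size; exact: ik.
rewrite big1 ?mul1r // => i _; rewrite mxE.
by have /monicP := f_monic i; rewrite lead_coefE f_size.
Qed.

(** For even [d], rotation by [d] is the square of rotation by [d./2], hence an even permutation. *)
Lemma det_rotate_rows (R : comNzRingType) (d n : nat)
    (r : nat -> 'rV[R]_(d + n)) : ~~ odd d ->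
  \det (\matrix_(i < d + n) r i) =
  \det (\matrix_(i < d + n) r ((i + n) %% (d + n))%N).
Proof.
move=> d_even; pose t := perm (@ordS_inj (d + n)).
have tE k i : val ((t ^+ k)%g i) = ((i + k) %% (d + n))%N.
  rewrite permX; elim: k => [|k IHk] /=; first by rewrite addn0 modn_small.
  by rewrite permE /= IHk -addn1 modnDml -addnA addn1.
have -> : \matrix_(i < d + n) r i =
    row_perm (t ^+ d)%g (\matrix_(i < d + n) r ((i + n) %% (d + n))%N).
  apply/matrixP => i c; rewrite !mxE tE modnDml -addnA modnDr.
  by rewrite modn_small.
have t_even : odd_perm (t ^+ d)%g = false.
  have -> : (t ^+ d = t ^+ d./2 * t ^+ d./2)%g.
    by rewrite -expgD addnn even_halfK.
  by rewrite odd_permM addbb.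
by rewrite row_permE det_mulmx det_perm t_even mul1r.
Qed.

(* Both sides equal, up to the two block-triangular factors, the determinant of
   the functionals [phi] and [L (_ * g j)] on the polynomials of degree less
   than [d + n]; on the left they are evaluated at the family 1, X, ...,
   X^(d-1), q g_0, q g_1, ..., on the right at P_0, P_1, ... *)
Lemma det_christoffel (R : comNzRingType) (d n : nat)
    (L : {linear {poly R} -> R^o}) (phi : {linear {poly R} -> 'rV[R]_d})
    (q : {poly R}) (g P : nat -> {poly R}) :
  ~~ odd d -> q \is monic -> size q = d.+1 -> (forall p, phi (q * p) = 0) ->
  (forall i, g i \is monic) -> (forall i, size (g i) = i.+1) ->
  (forall i, P i \is monic) -> (forall i, size (P i) = i.+1) ->
  (forall i j, (j <= i)%N -> L (P i * g j) = (i == j)%:R) ->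
  \det (\matrix_(i < d) phi 'X^i) *
    \det (\matrix_(i < n, j < n) L (q * g i * g j)) =
  \det (\matrix_(i < d) phi (P (n + i)%N)).
Proof.
move=> d_even q_monic q_size phi_q g_monic g_size P_monic P_size LPg.
have [psi psil psir] : exists2 psi : {linear {poly R} -> 'rV[R]_(d + n)},
    forall p c, psi p 0 (lshift n c) = phi p 0 c &
    forall p j, psi p 0 (rshift d j) = L (p * g j).
  pose psi p : 'rV[R]_(d + n) := row_mx (phi p) (\row_j L (p * g j)).
  have psi_lin : linear psi.
    move=> a u v; rewrite /psi scale_row_mx add_row_mx linearP; congr row_mx.
    by apply/rowP => j; rewrite !mxE mulrDl -scalerAl linearP.
  pose psiL : {linear {poly R} -> 'rV[R]_(d + n)} :=
    HB.pack psi (GRing.isLinear.Build _ _ _ _ psi psi_lin).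
  by exists psiL => p c; rewrite /= /psi ?row_mxEl ?row_mxEr ?mxE.
pose f i := if (i < d)%N then 'X^i else q * g (i - d)%N.
have f_monic i : f i \is monic.
  by rewrite /f; case: ifP => _; rewrite ?monicXn // monicMl.
have f_size i : size (f i) = i.+1.
  rewrite /f; case: ltnP => id; first by rewrite size_polyXn.
  rewrite size_monicM ?monic_neq0 // q_size g_size; lia.
have := det_monic_family _ _ psi f f_monic f_size.
rewrite -(det_monic_family _ _ psi P P_monic P_size).
rewrite (det_rotate_rows _ _ _ (fun i => psi (P i))) //.
set A := \matrix_i psi (f i); set B := \matrix_i _ => detAB.
have -> : \matrix_(i < d) phi 'X^i = ulsubmx A.
  by apply/matrixP => i c; rewrite !mxE psil /f /= ltn_ord.
have -> : \matrix_(i, j) L (q * g i * g j) = drsubmx A.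
  by apply/matrixP => i j; rewrite !mxE psir /f ltnNge leq_addr /= addKn.
have dlA : dlsubmx A = 0.
  apply/matrixP => i c.
  by rewrite !mxE psil /f ltnNge leq_addr /= addKn phi_q mxE.
(* After the rotation the top rows belong to P_n, ..., P_(n+d-1), orthogonal to every g_j with j <
   n. *)
have urB : ursubmx B = 0.
  apply/matrixP => i j; rewrite !mxE psir modn_small ?ltn_add2r //=.
  have jn := ltn_ord j.
  by rewrite LPg; [case: eqP => //; lia | lia].
have rE (i : 'I_n) : ((d + i + n) %% (d + n))%N = i.
  by rewrite addnAC modnDl modn_small // (leq_trans (ltn_ord i)) ?leq_addl.
rewrite -(det_ublock _ (ursubmx A)) -dlA submxK detAB -(submxK B) urB.
rewrite det_lblock.
(* The remaining block L (P_i g_j) is upper unitriangular by [LPg]; it is transposed because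
   [det_trig] expects lower triangular. *)
rewrite -(det_tr (drsubmx B)) [X in _ * X]det_trig; last first.
  apply/is_trig_mxP => i j ij.
  by rewrite !mxE psir /= rE LPg ?gtn_eqF // ltnW.
rewrite big1 ?mulr1 => [|i _]; last by rewrite !mxE psir /= rE LPg // eqxx.
congr (\det _); apply/matrixP => i c; rewrite !mxE psil /=.
by rewrite modn_small ?ltn_add2r // addnC.
Qed.

(** * Chebyshev polynomials and the functional with ballot moments *)

Fixpoint chebyshev (k : nat) : {poly int} :=
  match k with
  | 0 => 1
  | k1.+1 => if k1 is k2.+1 then 'X * chebyshev k1 - chebyshev k2 else 'X
  end.

Lemma chebyshevSS k : chebyshev k.+2 = 'X * chebyshev k.+1 - chebyshev k.
Proof. by []. Qed.

Lemma chebyshev_monic_size k :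
  chebyshev k \is monic /\ size (chebyshev k) = k.+1.
Proof.
suff: forall k, (chebyshev k \is monic /\ size (chebyshev k) = k.+1) /\
    (chebyshev k.+1 \is monic /\ size (chebyshev k.+1) = k.+2).
  by move=> /(_ k) [].
elim=> [|{}k [[mk sk] [mk1 sk1]]].
  by split; split; rewrite ?monic1 ?size_poly1 ?monicX ?size_polyX.
split=> //; rewrite chebyshevSS.
have sX : size ('X * chebyshev k.+1) = k.+3.
  by rewrite size_monicM ?monicX ?monic_neq0 // size_polyX sk1.
have slt : (size (- chebyshev k)%R < size ('X * chebyshev k.+1)%R)%N.
  by rewrite size_polyN sk sX.
split; last by rewrite size_polyDl.
by rewrite monicE lead_coefDl // -monicE monicMl ?monicX.
Qed.

(* The number of nonnegative +1/-1 paths from 0 to k with n steps, by the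
   reflection principle. *)
Definition ballot (n k : nat) : int :=
  if odd (n + k) then 0
  else 'C(n, (n + k)./2)%:Z - 'C(n, ((n + k)./2).+1)%:Z.

Lemma ballotS n k : ballot n.+1 k.+1 = ballot n k + ballot n k.+2.
Proof.
rewrite /ballot !addSn !addnS /= !negbK; case: ifP => // _.
rewrite !binS !PoszD; ring.
Qed.

Lemma ballotS0 n : ballot n.+1 0 = ballot n 1.
Proof.
rewrite /ballot addn0 addn1; case: ifP => // n_even.
have n2 : (n = (n.+1)./2 + (n.+1)./2.-1)%N.
  have := odd_double_half n.+1; rewrite n_even; lia.
case: (n.+1)./2 n2 => [|h] n2; first by rewrite n2 in n_even.
rewrite !binS !PoszD.
(* Here n = 2h + 1, so these are the two equal central binomials. *)
have -> : 'C(n, h.+1) = 'C(n, h).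
  by rewrite -bin_sub; [congr 'C(_, _)|]; lia.
ring.
Qed.

Lemma ballot_odd n : odd n -> ballot n 0 = 0.
Proof. by rewrite /ballot addn0 => ->. Qed.

Lemma ballot_catalan k : ballot (2 * k) 0 = (catalan k)%:Z.
Proof.
rewrite /ballot addn0 mul2n odd_double half_double -mul2n.
have := catalanE k; have := mul_bin_left (2 * k) k.
have -> : (2 * k - k = k)%N by lia.
nia.
Qed.

(** The functional L of the overview. *)
Definition ballot_sum (p : {poly int}) : int :=
  \sum_(i < size p) p`_i * ballot i 0.

Lemma ballot_sum_widen (N : nat) (p : {poly int}) : (size p <= N)%N ->
  ballot_sum p = \sum_(i < N) p`_i * ballot i 0.
Proof.
move=> pN; rewrite /ballot_sum.
rewrite (big_ord_widen _ (fun i => p`_i * ballot i 0) pN) big_mkcond.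
apply: eq_bigr => i _; case: ltnP => // pi.
by rewrite nth_default // mul0r.
Qed.

Lemma ballot_sum_linear : linear (ballot_sum : {poly int} -> int^o).
Proof.
move=> a p q; pose N := maxn (size p) (size q).
have pN : (size p <= N)%N by apply: leq_maxl.
have qN : (size q <= N)%N by apply: leq_maxr.
have pqN : (size (a *: p + q)%R <= N)%N.
  rewrite (leq_trans (size_polyD _ _)) // geq_max qN andbT.
  exact: leq_trans (size_scale_leq _ _) pN.
rewrite (ballot_sum_widen _ _ pN) (ballot_sum_widen _ _ qN).
rewrite (ballot_sum_widen _ _ pqN) scaler_sumr -big_split /=.
by apply: eq_bigr => i _; rewrite coefD coefZ mulrDl -mulrA.
Qed.

HB.instance Definition _ :=
  GRing.isLinear.Build int {poly int} int^o _ ballot_sum ballot_sum_linear.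

Lemma ballot_sumXn n : ballot_sum 'X^n = ballot n 0.
Proof.
rewrite /ballot_sum size_polyXn big_ord_recr /= coefXn eqxx mul1r.
rewrite big1 ?add0r // => i _; rewrite coefXn ltn_eqF ?mul0r //.
Qed.

(** X S_(k+1) = S_(k+2) + S_k mirrors [ballotS], the choice between a step up and a step down. *)
Lemma ballot_sum_chebyshev n k :
  ballot_sum ('X^n * chebyshev k) = ballot n k.
Proof.
suff: forall k, (forall n, ballot_sum ('X^n * chebyshev k) = ballot n k) /\
    (forall n, ballot_sum ('X^n * chebyshev k.+1) = ballot n k.+1).
  by move=> /(_ k) [].
elim=> [|{n}{}k [IHk IHk1]]; split=> // {}n.
- by rewrite mulr1 ballot_sumXn.
- by rewrite -exprSr ballot_sumXn ballotS0.
- rewrite chebyshevSS mulrBr mulrA -exprSr linearB /= IHk IHk1 ballotS.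
  by rewrite addrC addKr.
Qed.

(** * Motzkin paths and powers of the Motzkin series *)

(* The number of Motzkin paths from 0 to height k with n steps. *)
Definition motzkin_path (n k : nat) : int :=
  ballot_sum ((1 + 'X) ^+ n * chebyshev k).

Lemma motzkin_pathS0 n :
  motzkin_path n.+1 0 = motzkin_path n 0 + motzkin_path n 1.
Proof.
by rewrite /motzkin_path exprSr !mulr1 mulrDr mulr1 linearD.
Qed.

Lemma motzkin_pathSS n k : motzkin_path n.+1 k.+1 =
  motzkin_path n k + motzkin_path n k.+1 + motzkin_path n k.+2.
Proof.
rewrite /motzkin_path -!linearD; congr (ballot_sum _).
rewrite chebyshevSS exprSr; ring.
Qed.

Lemma motzkin_path0 k : motzkin_path 0 k = (k == 0%N)%:R.
Proof.
rewrite (ballot_sum_chebyshev 0 k : motzkin_path 0 k = _) /ballot.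
case: k => [|k] //; case: ifP => // k_even.
by rewrite !bin_small //; lia.
Qed.

(** Height n is reached in n steps only by going up throughout. This supplies the orthogonality
    required by [det_christoffel]. *)
Lemma motzkin_path_small n k : (n <= k)%N ->
  motzkin_path n k = (n == k)%:R.
Proof.
elim: n k => [|n IHn] [|k] //; rewrite ?motzkin_path0 // => nk.
by rewrite motzkin_pathSS !IHn; lia.
Qed.

Lemma sum_double (f : nat -> int) (m : nat) :
  \sum_(j < 2 * m) f j = \sum_(k < m) (f (2 * k)%N + f (2 * k).+1).
Proof.
elim: m => [|m IHm]; first by rewrite !big_ord0.
by rewrite mulnS !big_ord_recr /= IHm addrA.
Qed.

(** Expanding (1 + X)^n chooses the non-level steps, which form a Dyck path; only even lengths
    contribute. *)
Lemma motzkin_path_motzkin n : motzkin_path n 0 = motzkin_gf n.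
Proof.
rewrite /motzkin_path mulr1 exprDn linear_sum /=.
transitivity (\sum_(j < 2 * n.+1) 'C(n, j)%:Z * ballot j 0).
  rewrite (big_ord_widen (2 * n.+1)
    (fun j => ballot_sum ((1 ^+ (n - j) * 'X^j) *+ 'C(n, j)))); last lia.
  rewrite big_mkcond; apply: eq_bigr => j _; case: ltnP => [jn|nj].
    by rewrite expr1n mul1r linearMn /= ballot_sumXn -mulr_natl natz.
  by rewrite bin_small ?mul0r.
rewrite (sum_double (fun j => 'C(n, j)%:Z * ballot j 0)).
rewrite /motzkin_gf /motzkin -[RHS]natz natr_sum; apply: eq_bigr => k _.
rewrite (@ballot_odd (2 * k).+1) ?mulr0 ?addr0;
  last by rewrite /= mul2n odd_double.
by rewrite ballot_catalan natz PoszM.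
Qed.

(* Decomposition at the last visit to height 0. *)
Lemma motzkin_path_conv n k :
  \sum_(i < n.+1) motzkin_path i 0 * motzkin_path (n - i) k =
  motzkin_path n.+1 k.+1.
Proof.
elim: n k => [|n IHn] k.
  rewrite big_ord_recl big_ord0 addr0 subnn motzkin_pathSS !motzkin_path0.
  by rewrite mul1r !addr0.
rewrite big_ord_recr /= subnn motzkin_path0.
under eq_bigr => i _ do rewrite (subSn (leq_ord i)).
case: k => [|k].
  under eq_bigr => i _ do rewrite motzkin_pathS0 mulrDr.
  by rewrite big_split /= !IHn mulr1 addrC addrA -motzkin_pathSS.
under eq_bigr => i _ do rewrite motzkin_pathSS !mulrDr.
by rewrite !big_split /= !IHn mulr0 addr0 -motzkin_pathSS.
Qed.

Lemma fps_exp_motzkin k n :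
  fps_exp motzkin_gf k.+1 n = motzkin_path (n + k) k.
Proof.
elim: k n => [|k IHk] n.
  rewrite /fps_exp /= /fps_mul big_ord_recr /= subnn mulr1 addn0.
  rewrite motzkin_path_motzkin.
  rewrite big1 ?add0r // => i _; rewrite /fps_one.
  by rewrite (_ : (n - i == 0)%N = false) ?mulr0 //; have := ltn_ord i; lia.
rewrite -[LHS]/(\sum_(i < n.+1)
  motzkin_gf i * fps_exp motzkin_gf k.+1 (n - i)%N).
rewrite addnS -motzkin_path_conv -addSn big_split_ord.
(* For i > n fewer than k steps remain, too few to reach height k. *)
rewrite [X in _ = _ + X]big1 ?addr0.
  apply: eq_bigr => i _; rewrite IHk motzkin_path_motzkin /=.
  by congr (_ * motzkin_path _ _); have := ltn_ord i; lia.
move=> i _ /=; have ik := ltn_ord i.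
rewrite [X in _ * X]motzkin_path_small; last lia.
by rewrite (_ : _ == _ = false) ?mulr0 //; lia.
Qed.

(** * Explicit evaluation of the 6 x 6 determinants *)

(* Laplace expansion along the first column; zero entries are encoded as [None],
   so that unfolding [sparse_det] discards their minors. *)
Fixpoint sparse_det (R : comPzRingType) (n : nat)
    (rows : seq (seq (option R))) : R :=
  if n is n1.+1 then
    foldr (fun i s =>
      if nth None (nth [::] rows i) 0 is Some x then
        x * ((-1) ^+ i *
          sparse_det R n1 (map behead (take i rows ++ drop i.+1 rows))) + s
      else s) 0 (iota 0 n)
  else 1.

Lemma det_sparse (R : comPzRingType) (n : nat) (rows : seq (seq (option R))) :
  size rows = n ->
  \det (\matrix_(i < n, j < n) odflt 0 (nth None (nth [::] rows i) j)) =
  sparse_det R n rows.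
Proof.
elim: n rows => [|n IHn] rows rows_n; first exact: det_mx00.
pose minor i := map behead (take i rows ++ drop i.+1 rows).
pose c i := odflt 0 (nth None (nth [::] rows i) 0) *
  ((-1) ^+ i * sparse_det R n (minor i)).
rewrite (expand_det_col _ ord0); transitivity (\sum_(i < n.+1) c i).
  apply: eq_bigr => i _; rewrite mxE /cofactor addn0 /c.
  have i_n : (i <= n)%N := leq_ord i.
  have size_minor : size (take i rows ++ drop i.+1 rows) = n.
    by rewrite size_cat size_take size_drop rows_n ltnS i_n subSS subnKC.
  rewrite -IHn ?size_map //.
  congr (_ * (_ * \det _)); apply/matrixP => k j; rewrite !mxE.
  rewrite (nth_map [::]) ?size_minor // nth_behead nth_cat size_take rows_n ltnS
    i_n /= /bump.
  case: (ltnP k i) => ki; first by rewrite nth_take // leqNgt ki.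
  by rewrite nth_drop addSn subnKC ?ki.
rewrite -(big_mkord xpredT c) /index_iota subn0 [RHS]/sparse_det -/sparse_det.
elim: (iota 0 n.+1) => [|i s IHs]; first by rewrite big_nil.
rewrite big_cons IHs /c /=.
by case: (nth None _ 0) => [x|] //=; rewrite mul0r add0r.
Qed.

(* [residue_simple false m] is S_m modulo X^3 - 2X in the basis 1, X, X^2;
   advancing m by 4 amounts to flipping the boolean. *)
Fixpoint residue_simple (R : pzRingType) (b : bool) (m : nat) :
    seq (option R) :=
  match m with
  | 0 => [:: Some 1; None; if b then Some (-1) else None]
  | 1 => [:: None; Some (if b then -1 else 1); None]
  | 2 => [:: Some (-1); None; if b then None else Some 1]
  | 3 => [:: None; None; None]
  | m1.+4 => residue_simple R (~~ b) m1
  end.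

(* [residue_triple c (c (c + 1) / 2) m] is S_(3c + m) modulo (X + 1)^3 in
   the basis 1, X + 1, (X + 1)^2. *)
Fixpoint residue_triple (R : pzRingType) (a t : R) (m : nat) : seq (option R) :=
  match m with
  | 0 => [:: Some 1; Some a; Some (- (3 * t))]
  | 1 => [:: Some (-1); Some (a + 1); Some (3 * t)]
  | 2 => [:: None; Some (- (2 * (a + 1))); Some (a + 1)]
  | m1.+3 => residue_triple R (a + 1) (t + a + 1) m1
  end.

(** Here c = 4z, so c (c + 1) / 2 = 8z^2 + 2z; for [b] the parity of z the rows are the residues of
    S_(12z+k), ..., S_(12z+k+5). *)
Definition residue_det (R : comPzRingType) (b : bool) (z : R) (k : nat) : R :=
  sparse_det R 6
    [seq residue_simple R b i ++ residue_triple R (4 * z) (8 * z ^+ 2 + 2 * z) i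
    | i <- iota k 6].

Ltac compute_residue_det :=
  match goal with |- context [residue_det _ ?b _ _] => case: b end;
  cbv [residue_det sparse_det residue_simple residue_triple negb iota map
    foldr nth take drop behead cat];
  ring.

(** The period 8 modulo X^3 - 2X would suggest period 24 in the index; both values of [b] give the
    same polynomials in z, whence 12. *)
Lemma residue_detE (R : comNzRingType) (b : bool) (z : R) :
  (residue_det R b z 0 = 1 /\ residue_det R b z 1 = 1) /\
  residue_det R b z 2 = 2 * (2 * z + 1) * (8 * z - 1) /\
  residue_det R b z 3 = - 2 * (8 * z + 9) * (2 * z + 1) /\
  (residue_det R b z 4 = -1 /\ residue_det R b z 5 = -1) /\
  residue_det R b z 6 = 4 * (z + 1) * (8 * z + 5) /\
  (residue_det R b z 7 = 64 * (z + 1) ^+ 2 /\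
   residue_det R b z 10 = - 64 * (z + 1) ^+ 2) /\
  (residue_det R b z 8 = 0 /\ residue_det R b z 9 = 0) /\
  residue_det R b z 11 = - 4 * (z + 1) * (8 * z + 11).
Proof.
by repeat split; compute_residue_det.
Qed.

(** * Residues modulo the weight q *)

Definition sparse_row (s : seq (option int)) : 'rV[int]_6 :=
  \row_j odflt 0 (nth None s j).

(* Multiplication by X on Z[X]/(X^3 - 2X) x Z[X]/(X + 1)^3, in the bases 1, X,
   X^2 and 1, X + 1, (X + 1)^2. *)
Definition mulX_mx : 'M[int]_6 :=
  \matrix_(i, j) (nth [::]
    [:: [:: 0; 1; 0; 0; 0; 0]; [:: 0; 0; 1; 0; 0; 0]; [:: 0; 2; 0; 0; 0; 0];
        [:: 0; 0; 0; -1; 1; 0]; [:: 0; 0; 0; 0; -1; 1]; [:: 0; 0; 0; 0; 0; -1]]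
    i)`_j.

(** The row vector is 1 in both quotients, and p acts on it through multiplication by X. *)
Definition residue (p : {poly int}) : 'rV[int]_6 :=
  sparse_row [:: Some 1; None; None; Some 1; None; None] *m horner_mx mulX_mx p.

Lemma residue_linear : linear residue.
Proof. by move=> a p q; rewrite /residue linearP mulmxDr scalemxAr. Qed.

HB.instance Definition _ :=
  GRing.isLinear.Build int {poly int} 'rV[int]_6 _ residue residue_linear.

Lemma residue_mulX p : residue ('X * p) = residue p *m mulX_mx.
Proof. by rewrite mulrC /residue rmorphM /= horner_mx_X -mulmxA. Qed.

Lemma mulmx_mulX a0 a1 a2 b0 b1 b2 :
  \row_j [:: a0; a1; a2; b0; b1; b2]`_j *m mulX_mx =
  \row_j [:: 0; a0 + 2 * a2; a1; - b0; b0 - b1; b1 - b2]`_j.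
Proof.
apply/rowP => j; rewrite !mxE !big_ord_recl big_ord0 !mxE.
by case: j => [] [|[|[|[|[|[|]]]]]] //= _; ring.
Qed.

Lemma residue1 : residue 1 = \row_j [:: 1; 0; 0; 1; 0; 0]`_j.
Proof.
rewrite /residue rmorph1 mulmx1; apply/rowP => j; rewrite !mxE.
by case: j => [] [|[|[|[|[|[|]]]]]].
Qed.

Lemma residueX : residue 'X = \row_j [:: 0; 1; 0; -1; 1; 0]`_j.
Proof.
rewrite -['X]mulr1 residue_mulX residue1 mulmx_mulX.
by apply/rowP => j; rewrite !mxE; case: j => [] [|[|[|[|[|[|]]]]]].
Qed.

Definition weight : {poly int} := (1 + 'X) ^+ 3 * chebyshev 3.

Lemma weight_monic : weight \is monic.
Proof.
by rewrite /weight addrC -polyC1 monicMl ?monic_exp ?monicXaddC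
  ?(chebyshev_monic_size 3).1.
Qed.

Lemma size_weight : size weight = 7.
Proof.
rewrite /weight addrC -polyC1 size_monicM ?monic_exp ?monicXaddC ?monic_neq0
  ?(chebyshev_monic_size 3).1 //.
have := size_exp ('X + 1%:P : {poly int}) 3.
by rewrite size_XaddC (chebyshev_monic_size 3).2; case: (size _) => //= _ ->.
Qed.

Lemma residue_weight p : residue (weight * p) = 0.
Proof.
suff r0 : residue weight = 0.
  by rewrite /residue rmorphM /= mulmxA [X in X *m _]r0 mul0mx.
(* The expansion of (X + 1)^3 (X^3 - 2X), nested so that [residue_mulX] applies. *)
have -> : weight = 'X * ('X * ('X * ('X * ('X * ('X * 1)))))
    + 3 *: ('X * ('X * ('X * ('X * ('X * 1))))) + 'X * ('X * ('X * ('X * 1)))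
    - 5 *: ('X * ('X * ('X * 1))) - 6 *: ('X * ('X * 1)) - 2 *: ('X * 1).
  rewrite /weight /= -!mul_polyC; ring.
rewrite !(linearD, linearN, linearZ) /= !residue_mulX residue1 !mulmx_mulX.
by apply/rowP => j; rewrite !mxE; case: j => [] [|[|[|[|[|[|]]]]]].
Qed.

(** Up to sign this is the resultant of X^3 - 2X and (X + 1)^3, a unit since X^3 - 2X takes the
    value 1 at -1. *)
Lemma det_residue_Xn : \det (\matrix_(i < 6) residue 'X^i) = 1.
Proof.
transitivity (sparse_det int 6
  (map (map Some) [:: [:: 1; 0; 0; 1; 0; 0]; [:: 0; 1; 0; -1; 1; 0];
      [:: 0; 0; 1; 1; -2; 1]; [:: 0; 2; 0; -1; 3; -3];
      [:: 0; 0; 2; 1; -4; 6]; [:: 0; 4; 0; -1; 5; -10]])); last by [].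
rewrite -det_sparse //; congr (\det _); apply/row_matrixP => i.
rewrite rowK; case: i => [] [|[|[|[|[|[|]]]]]] //= i6;
  rewrite ?exprS ?expr0 ?residue_mulX residue1 ?mulmx_mulX;
  by apply/rowP => j; rewrite !mxE; case: j => [] [|[|[|[|[|[|]]]]]].
Qed.

(** The Chebyshev recurrence in coordinates, with named entries so that [mulmx_mulX] applies. *)
Lemma residue_simple_rec b m : exists x0 x1 x2 y0 y1 y2,
  [/\ map (odflt 0) (residue_simple int b m) = [:: x0; x1; x2],
      map (odflt 0) (residue_simple int b m.+1) = [:: y0; y1; y2] &
      map (odflt 0) (residue_simple int b m.+2) =
        [:: 0 - x0; y0 + 2 * y2 - x1; y1 - x2]].
Proof.
elim/ltn_ind: m b => -[|[|[|[|m]]]] IHm b; last first.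
  by have [] := IHm m _ (~~ b); first lia; move=> x0; exists x0.
all: by case: b; do 6 eexists; split; reflexivity.
Qed.

Lemma residue_triple_rec a t m : exists x0 x1 x2 y0 y1 y2,
  [/\ map (odflt 0) (residue_triple int a t m) = [:: x0; x1; x2],
      map (odflt 0) (residue_triple int a t m.+1) = [:: y0; y1; y2] &
      map (odflt 0) (residue_triple int a t m.+2) =
        [:: - y0 - x0; y0 - y1 - x1; y1 - y2 - x2]].
Proof.
elim/ltn_ind: m a t => -[|[|[|m]]] IHm a t; last first.
  by have [] := IHm m _ (a + 1) (t + a + 1); first lia; move=> x0; exists x0.
all: do 6 eexists; split; [reflexivity | reflexivity |].
all: by congr [:: _; _; _]; rewrite /=; ring.
Qed.

Lemma sparse_rowE s : sparse_row s = \row_j (map (odflt 0) s)`_j.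
Proof.
apply/rowP => j; rewrite !mxE.
by elim: s (j : nat) => [|x s IHs] [|i] //=.
Qed.

Lemma residue_chebyshev m :
  residue (chebyshev m) =
  sparse_row (residue_simple int false m ++ residue_triple int 0 0 m).
Proof.
suff: forall m,
    residue (chebyshev m) =
      sparse_row (residue_simple int false m ++ residue_triple int 0 0 m) /\
    residue (chebyshev m.+1) =
      sparse_row (residue_simple int false m.+1 ++ residue_triple int 0 0 m.+1).
  by move=> /(_ m) [].
elim=> [|{}m [IH0 IH1]].
  by rewrite residue1 residueX !sparse_rowE.
split=> //; rewrite chebyshevSS linearB /= residue_mulX IH0 IH1 !sparse_rowE.
have [x0 [x1 [x2 [y0 [y1 [y2 [Ax Ay Az]]]]]]] := residue_simple_rec false m.
have [u0 [u1 [u2 [v0 [v1 [v2 [Bx By Bz]]]]]]] := residue_triple_rec 0 0 m.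
rewrite !map_cat Ax Ay Az Bx By Bz /= mulmx_mulX.
by apply/rowP => j; rewrite !mxE; case: j => [] [|[|[|[|[|[|]]]]]].
Qed.

(** * Shifts of the index by 12 and the Hankel determinants *)

(** A block of 12 is three blocks of 4, so it flips the boolean an odd number of times. *)
Lemma residue_simple_shift b n k :
  residue_simple int b (12 * n + k) = residue_simple int (b (+) odd n) k.
Proof.
elim: n b => [|n IHn] b; first by rewrite addbF.
by rewrite mulnS -addnA [LHS]IHn negbK addNb addbN.
Qed.

(** A block of 12 is four blocks of 3: it adds 4 to [a] and 4a + 10 to [t]. *)
Lemma residue_triple_shift a t n k : residue_triple int a t (12 * n + k) =
  residue_triple int (a + 4 * n%:Z)
    (t + 4 * n%:Z * a + (8 * n%:Z ^+ 2 + 2 * n%:Z)) k.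
Proof.
elim: n a t => [|n IHn] a t.
  by congr (residue_triple _ _ _ k); ring.
by rewrite mulnS -addnA [LHS]IHn intS; congr (residue_triple _ _ _ k); ring.
Qed.

(** With g_i = (1 + X)^i, [fps_exp_motzkin] reads the entry (i, j) as L (q g_i g_j). *)
Lemma hankel_christoffel N :
  hankel N (F 4) = \det (\matrix_(i < 6) residue (chebyshev (N + i)%N)).
Proof.
pose g i : {poly int} := (1 + 'X) ^+ i.
have gE i : g i = ('X + 1%:P) ^+ i by rewrite /g addrC.
have g_monic i : g i \is monic by rewrite gE monic_exp ?monicXaddC.
have g_size i : size (g i) = i.+1.
  have := size_exp ('X + 1%:P : {poly int}) i.
  rewrite -gE size_XaddC mul1n; have := monic_neq0 (g_monic i).
  by rewrite -size_poly_gt0; case: (size _) => //= s _ ->.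
have cheb_monic i := (chebyshev_monic_size i).1.
have cheb_size i := (chebyshev_monic_size i).2.
rewrite -(det_christoffel _ 6 N ballot_sum residue weight g chebyshev) //.
- rewrite det_residue_Xn mul1r; congr (\det _); apply/matrixP => i j.
  rewrite !mxE /F fps_exp_motzkin /motzkin_path; congr ballot_sum.
  by rewrite /weight /g !exprD; ring.
- exact: weight_monic.
- exact: size_weight.
- exact: residue_weight.
- move=> i j ji; rewrite mulrC -[LHS]/(motzkin_path j i) motzkin_path_small //.
  by rewrite eq_sym.
Qed.

Lemma hankel_residue_det n k :
  hankel (12 * n + k) (F 4) = residue_det int (odd n) n%:Z k.
Proof.
rewrite hankel_christoffel /residue_det -det_sparse ?size_map //.
congr (\det _); apply/matrixP => i j; rewrite mxE residue_chebyshev !mxE.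
rewrite (nth_map 0%N) ?size_iota // nth_iota // -addnA residue_simple_shift.
by rewrite residue_triple_shift mulr0 !add0r.
Qed.

(* Deviation from the printed source: the source gives -64(n+1)^2 at the index
   12n+7, which is false already for n = 0, where the determinant is +64. The
   sign is corrected here; every other value is as printed. *)
Theorem theorem3 (n : nat) :
  (hankel (12 * n) (F 4) = 1 /\ hankel (12 * n + 1) (F 4) = 1) /\
  hankel (12 * n + 2) (F 4) = 2 * (2 * n%:Z + 1) * (8 * n%:Z - 1) /\
  hankel (12 * n + 3) (F 4) = - 2 * (8 * n%:Z + 9) * (2 * n%:Z + 1) /\
  (hankel (12 * n + 4) (F 4) = -1 /\ hankel (12 * n + 5) (F 4) = -1) /\
  hankel (12 * n + 6) (F 4) = 4 * (n%:Z + 1) * (8 * n%:Z + 5) /\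
  (hankel (12 * n + 7) (F 4) = 64 * (n%:Z + 1) ^+ 2 /\
   hankel (12 * n + 10) (F 4) = - 64 * (n%:Z + 1) ^+ 2) /\
  (hankel (12 * n + 8) (F 4) = 0 /\ hankel (12 * n + 9) (F 4) = 0) /\
  hankel (12 * n + 11) (F 4) = - 4 * (n%:Z + 1) * (8 * n%:Z + 11).
Proof.
rewrite -[X in hankel X _ = 1 /\ _]addn0 !hankel_residue_det.
exact: residue_detE.
Qed.
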